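(* In the steady state of the D-$MAP/G_n^{(a,b)}/1$ queue, the probability vectors $\{\mathbf{p}(n,0),\boldsymbol{\pi}(n,r)\}$ at an arbitrary epoch and $\{\boldsymbol{\pi}^+(n,r),\boldsymbol{\phi}^+(n)\}$ at the departure epoch are connected by $$\mathbf{p}(n,0)=\Omega^{-1}\sum_{j=0}^{n}\boldsymbol{\phi}^+(j)\,\overline{\mathbf{D}}^{\,n-j}(\mathbf{I}-\mathbf{C})^{-1},\qquad 0\le n\le a-1,$$ $$\boldsymbol{\pi}(0,a)=\Big(\mathbf{p}(a-1,0)\mathbf{D}+\Omega^{-1}\big(\boldsymbol{\phi}^+(a)-\boldsymbol{\pi}^+(0,a)\big)\Big)(\mathbf{I}-\mathbf{C})^{-1},$$ $$\boldsymbol{\pi}(0,r)=\Omega^{-1}\big(\boldsymbol{\phi}^+(r)-\boldsymbol{\pi}^+(0,r)\big)(\mathbf{I}-\mathbf{C})^{-1},\qquad a+1\le r\le b,$$ $$\boldsymbol{\pi}(n,r)=\Big(\boldsymbol{\pi}(n-1,r)\mathbf{D}-\Omega^{-1}\boldsymbol{\pi}^+(n,r)\Big)(\mathbf{I}-\mathbf{C})^{-1},\qquad n\ge 1,\ a\le r\le b-1,$$ $$\boldsymbol{\pi}(n,b)=\Big(\boldsymbol{\pi}(n-1,b)\mathbf{D}+\Omega^{-1}\big(\boldsymbol{\phi}^+(n+b)-\boldsymbol{\pi}^+(n,b)\big)\Big)(\mathbf{I}-\mathbf{C})^{-1},\qquad n\ge 1.$$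
   Context: **Model (D-$MAP/G_n^{(a,b)}/1$, infinite buffer, discrete time).** Fix integers $1\le a\le b$ and $m\ge 1$. All vectors are row vectors of length $m$ except $\boldsymbol{e}$, the column vector of ones; $\mathbf{I}$ is the $m\times m$ identity. Arrivals: a discrete-time Markovian arrival process given by nonnegative $m\times m$ matrices $\mathbf{C}=[C_{ij}]$, $\mathbf{D}=[D_{ij}]$, each with at least one positive entry, such that $\mathbf{C}+\mathbf{D}$ is stochastic and irreducible. In each slot the phase moves from $i$ to $j$ without an arrival with probability $C_{ij}$, and with one arrival with probability $D_{ij}$. Let $\overline{\boldsymbol{\pi}}$ be the stationary probability vector of $\mathbf{C}+\mathbf{D}$ and $\lambda^*=\overline{\boldsymbol{\pi}}\mathbf{D}\boldsymbol{e}$. Service: a single server uses the general bulk service $(a,b)$ rule. With fewer than $a$ customers in the queue the server idles until $a$ have accumulated; with $r$ customers, $a\le r\le b$, it takes them all as one batch; with more than $b$ it takes the first $b$. The service time of a batch of size $r$ ($a\le r\le b$) has probability mass function $s_r(k)$, $k\ge1$, and finite mean $S_r=\sum_{k\ge1}k\,s_r(k)=\mu_r^{-1}$. Timing (late arrival system with delayed access): slots have unit length; a potential arrival occurs in $(t-,t)$ and a potential departure in $(t,t+)$; an arrival that finds the server idle cannot depart in the slot in which it arrives. Stability is assumed: $\rho=\lambda^*/(b\mu_b)<1$. **Steady-state quantities.** Observing the system at $t-$ (just before a potential arrival) and letting $t\to\infty$: the $i$th component of $\mathbf{p}(n,0)$, $0\le n\le a-1$, is the limiting probability that the server is idle, $n$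 customers are in the queue and the arrival phase is $i$; the $i$th component of $\boldsymbol{\pi}(n,r,u)$, $n\ge0$, $a\le r\le b$, $u\ge1$, is the limiting probability that the server is busy with a batch of size $r$, $n$ customers are waiting in the queue, the phase is $i$ and the remaining service time is $u$. These limits form a probability distribution and satisfy - $\mathbf{p}(0,0)=\mathbf{p}(0,0)\mathbf{C}+\sum_{r=a}^b\boldsymbol{\pi}(0,r,1)\mathbf{C}$; - $\mathbf{p}(n,0)=\mathbf{p}(n,0)\mathbf{C}+\sum_{r=a}^b\boldsymbol{\pi}(n,r,1)\mathbf{C}+\mathbf{p}(n-1,0)\mathbf{D}+\sum_{r=a}^b\boldsymbol{\pi}(n-1,r,1)\mathbf{D}$, for $1\le n\le a-1$; - $\boldsymbol{\pi}(0,a,u)=\boldsymbol{\pi}(0,a,u+1)\mathbf{C}+\big[\mathbf{p}(a-1,0)\mathbf{D}+\sum_{r=a}^b\boldsymbol{\pi}(a,r,1)\mathbf{C}+\sum_{r=a}^b\boldsymbol{\pi}(a-1,r,1)\mathbf{D}\big]s_a(u)$; - $\boldsymbol{\pi}(0,r,u)=\boldsymbol{\pi}(0,r,u+1)\mathbf{C}+\big[\sum_{i=a}^b\boldsymbol{\pi}(r,i,1)\mathbf{C}+\sum_{i=a}^b\boldsymbol{\pi}(r-1,i,1)\mathbf{D}\big]s_r(u)$, for $a+1\le r\le b$; - $\boldsymbol{\pi}(n,r,u)=\boldsymbol{\pi}(n,r,u+1)\mathbf{C}+\boldsymbol{\pi}(n-1,r,u+1)\mathbf{D}$, for $n\ge1$,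 $a\le r\le b-1$; - $\boldsymbol{\pi}(n,b,u)=\boldsymbol{\pi}(n,b,u+1)\mathbf{C}+\boldsymbol{\pi}(n-1,b,u+1)\mathbf{D}+\big[\sum_{r=a}^b\boldsymbol{\pi}(n+b,r,1)\mathbf{C}+\sum_{r=a}^b\boldsymbol{\pi}(n+b-1,r,1)\mathbf{D}\big]s_b(u)$, for $n\ge1$, for all $u\ge1$. The arbitrary-epoch vectors are $\mathbf{p}(n,0)$ and $\boldsymbol{\pi}(n,r)=\sum_{u\ge1}\boldsymbol{\pi}(n,r,u)$. Departure epoch: the $j$th component of $\boldsymbol{\pi}^+(n,r)$ is the steady-state probability that, at the departure epoch of a batch, the departing batch has size $r$, there are $n$ customers in the queue and the arrival phase is $j$. With $\Omega^{-1}=\sum_{n=0}^\infty\sum_{r=a}^b\boldsymbol{\pi}(n,r,1)\boldsymbol{e}$ one has $\boldsymbol{\pi}^+(0,r)=\Omega\,\boldsymbol{\pi}(0,r,1)\mathbf{C}$ and $\boldsymbol{\pi}^+(n,r)=\Omega\big(\boldsymbol{\pi}(n,r,1)\mathbf{C}+\boldsymbol{\pi}(n-1,r,1)\mathbf{D}\big)$ for $n\ge1$, $a\le r\le b$. Put $\boldsymbol{\phi}^+(n)=\sum_{r=a}^b\boldsymbol{\pi}^+(n,r)$. Finally $\overline{\mathbf{D}}=(\mathbf{I}-\mathbf{C})^{-1}\mathbf{D}$, with $\overline{\mathbf{D}}^{\,0}=\mathbf{I}$. *)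

(* Defs.v *)
From HB Require Import structures.
From mathcomp Require Import all_boot all_order all_algebra.
From mathcomp Require Import all_classical all_reals all_analysis.

Set Implicit Arguments.
Unset Strict Implicit.
Unset Printing Implicit Defensive.

Import Order.TTheory GRing.Theory Num.Theory.
Import numFieldNormedType.Exports.

Local Open Scope classical_set_scope.
Local Open Scope ring_scope.

Definition stochastic (R : realType) (m : nat) (P : 'M[R]_m) : Prop :=
  (forall i j, 0 <= P i j) /\ (forall i, \sum_j P i j = 1).

Definition irreducible (R : realType) (m : nat) (P : 'M[R]_m) : Prop :=
  forall i j, exists k : nat, 0 < (P ^+ k) i j.

Definition DMAP (R : realType) (m : nat) (C D : 'M[R]_m) : Prop :=
  [/\ (forall i j, 0 <= C i j) /\ (exists i j, 0 < C i j),
      (forall i j, 0 <= D i j) /\ (exists i j, 0 < D i j),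
      stochastic (C + D) & irreducible (C + D)].

Definition stationary_vector (R : realType) (m : nat) (P : 'M[R]_m)
    (v : 'rV[R]_m) : Prop :=
  [/\ forall i, 0 <= v 0 i, \sum_i v 0 i = 1 & v *m P = v].

Definition ones (R : realType) (m : nat) : 'cV[R]_m := const_mx 1.

(* [pibar] is the stationary vector of [C + D]. *)
Definition arrival_rate (R : realType) (m : nat) (D : 'M[R]_m)
  (pibar : 'rV[R]_m) : R := (pibar *m D *m ones R m) 0 0.

(* A service law is a function [s r : nat -> R] whose value at 0 is never
   used: service times are at least 1. *)
Definition mean_service (R : realType) (s : nat -> nat -> R) (r : nat) : R :=
  limn (series (fun k => k.+1%:R * s r k.+1)).

Definition service_rate (R : realType) (s : nat -> nat -> R) (r : nat) : R :=
  (mean_service s r)^-1.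

Definition service_law (R : realType) (s : nat -> nat -> R) (r : nat) : Prop :=
  [/\ forall k : nat, 0 <= s r k.+1,
      series (fun k => s r k.+1) @ \oo --> (1 : R)
    & cvgn (series (fun k => k.+1%:R * s r k.+1))].

(* The queue observed at t- is a Markov chain on pairs (configuration, phase).
   [Idle n]: server idle, n customers waiting.
   [Busy n r u]: n customers waiting, a batch of size r in service, with
   remaining service time u. *)
Definition config : Type := (nat + nat * nat * nat)%type.
Definition Idle (n : nat) : config := inl n.
Definition Busy (n r u : nat) : config := inr (n, r, u).
Definition state (m : nat) : Type := (config * 'I_m)%type.

Definition admissible (a b : nat) (c : config) : bool :=
  match c with
  | inl n => (n < a)%N
  | inr (n, r, u) => [&& (a <= r)%N, (r <= b)%N & (0 < u)%N]
  end.

Definition departing (c : config) : bool :=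
  if c is inr (_, _, u) then u == 1%N else false.

(* General bulk service (a,b) rule: probability that the next configuration is
   [c'] when the server is free and [n] customers are present, all events of
   the current slot being over. *)
Definition bulk_start (R : realType) (a b : nat) (s : nat -> nat -> R)
    (n : nat) (c' : config) : R :=
  if (n < a)%N then (c' == Idle n)%:R
  else if c' is inr (n', r, u) then
    if [&& r == minn n b, n' == (n - r)%N & (0 < u)%N] then s r u else 0
  else 0.

(* Probability of moving from [c] to [c'] in one slot, given whether there is
   an arrival in that slot ([x], counted as 0 or 1). The arrival precedes the
   departure, and a batch whose service starts at the end of the slot is seen
   with its full service time at the next observation epoch. *)
Definition config_step (R : realType) (a b : nat) (s : nat -> nat -> R)
    (c : config) (x : bool) (c' : config) : R :=
  match c with
  | inl n => bulk_start a b s (n + x)%N c'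
  | inr (n, r, u) =>
      if u == 1%N then bulk_start a b s (n + x)%N c'
      else (c' == Busy (n + x)%N r u.-1)%:R
  end.

Definition phase_step (R : realType) (m : nat) (C D : 'M[R]_m) (x : bool) :
  'M[R]_m := if x then D else C.

Definition transition (R : realType) (m : nat) (C D : 'M[R]_m) (a b : nat)
    (s : nat -> nat -> R) (y z : state m) : R :=
  \sum_(x : bool) phase_step C D x y.2 z.2 * config_step a b s y.1 x z.1.

Definition initial_law (R : realType) (m a b : nat) (q : state m -> R) : Prop :=
  [/\ forall y, 0 <= q y,
      (\esum_(y in [set: state m]) (q y)%:E = 1%:E)%E
    & forall y, ~~ admissible a b y.1 -> q y = 0].

Fixpoint law (R : realType) (m : nat) (C D : 'M[R]_m) (a b : nat)
    (s : nat -> nat -> R) (q : state m -> R) (t : nat) (z : state m) : \bar R :=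
  (if t is t'.+1 then
     \esum_(y in [set: state m])
        (law C D a b s q t' y * (transition C D a b s y z)%:E)
   else (q z)%:E)%E.

Definition prob (R : realType) (m : nat) (C D : 'M[R]_m) (a b : nat)
    (s : nat -> nat -> R) (q : state m -> R) (t : nat) (z : state m) : R :=
  fine (law C D a b s q t z).

Definition limit_prob (R : realType) (m : nat) (C D : 'M[R]_m) (a b : nat)
    (s : nat -> nat -> R) (q : state m -> R) (z : state m) : R :=
  limn (fun t => prob C D a b s q t z).

Definition has_steady_state (R : realType) (m : nat) (C D : 'M[R]_m)
    (a b : nat) (s : nat -> nat -> R) (q : state m -> R) : Prop :=
  (forall z, cvgn (fun t => prob C D a b s q t z)) /\
  (\esum_(z in [set: state m]) (limit_prob C D a b s q z)%:E = 1%:E)%E.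

Definition p_idle (R : realType) (m : nat) (C D : 'M[R]_m) (a b : nat)
    (s : nat -> nat -> R) (q : state m -> R) (n : nat) : 'rV[R]_m :=
  \row_i limit_prob C D a b s q (Idle n, i).

Definition pi_rem (R : realType) (m : nat) (C D : 'M[R]_m) (a b : nat)
    (s : nat -> nat -> R) (q : state m -> R) (n r u : nat) : 'rV[R]_m :=
  \row_i limit_prob C D a b s q (Busy n r u, i).

Definition pi_arb (R : realType) (m : nat) (C D : 'M[R]_m) (a b : nat)
    (s : nat -> nat -> R) (q : state m -> R) (n r : nat) : 'rV[R]_m :=
  \row_i limn (series (fun u => pi_rem C D a b s q n r u.+1 0 i)).

Definition departure_prob (R : realType) (m : nat) (C D : 'M[R]_m) (a b : nat)
    (s : nat -> nat -> R) (q : state m -> R) (t : nat) : R :=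
  fine (\esum_(y in [set y : state m | departing y.1]) law C D a b s q t y)%E.

(* Probability that, in slot [t], a batch of size [r] departs, leaving [n]
   customers in the queue and phase [j]. The departure takes place after the
   potential arrival [x] of the slot, and before the next batch is taken from
   the queue. *)
Definition departure_state_prob (R : realType) (m : nat) (C D : 'M[R]_m)
    (a b : nat) (s : nat -> nat -> R) (q : state m -> R)
    (t n r : nat) (j : 'I_m) : R :=
  \sum_(x : bool | (x <= n)%N) \sum_i
    prob C D a b s q t (Busy (n - x)%N r 1, i) * phase_step C D x i j.

(* Limit of the conditional probability given that a departure occurs. *)
Definition pi_dep (R : realType) (m : nat) (C D : 'M[R]_m) (a b : nat)
    (s : nat -> nat -> R) (q : state m -> R) (n r : nat) : 'rV[R]_m :=
  \row_j limn (fun t => departure_state_prob C D a b s q t n r j /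
                        departure_prob C D a b s q t).

Definition phi_dep (R : realType) (m : nat) (C D : 'M[R]_m) (a b : nat)
    (s : nat -> nat -> R) (q : state m -> R) (n : nat) : 'rV[R]_m :=
  \sum_(a <= r < b.+1) pi_dep C D a b s q n r.

Definition Omega (R : realType) (m : nat) (C D : 'M[R]_m) (a b : nat)
    (s : nat -> nat -> R) (q : state m -> R) : R :=
  (limn (series (fun n =>
     \sum_(a <= r < b.+1) (pi_rem C D a b s q n r 1 *m ones R m) 0 0)))^-1.

Definition Dbar (R : realType) (m : nat) (C D : 'M[R]_m) : 'M[R]_m :=
  invmx (1%:M - C) *m D.

(* Main.v *)
(* A configuration has finitely many admissible predecessors, so the one-step
   equation of the law is a finite sum and passes to the limit: this gives the balance
   equations of the limiting probabilities. Summing them over the remaining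
   service time telescopes the busy equations into linear relations between the
   [pi_arb n r], the [p_idle n] and the rows [slot (fun k => limit_row (Busy k r 1)) n].
   The latter are [Omega^-1 *: pi_dep n r], because the limit law has mass 1, so
   that the probability of a departure at time t converges to [Omega^-1]. As
   [1 - C] is invertible, each relation is then solved for its unknown. *)

Require Import Defs.
From HB Require Import structures.
From mathcomp Require Import all_boot all_order all_algebra.
From mathcomp Require Import all_classical all_reals all_analysis.
From mathcomp Require Import zify lra.

Set Implicit Arguments.
Unset Strict Implicit.
Unset Printing Implicit Defensive.

Import Order.TTheory GRing.Theory Num.Theory.
Import numFieldNormedType.Exports.

Local Open Scope classical_set_scope.
Local Open Scope ring_scope.

(** * Finite and unordered sums of nonnegative terms *)

Lemma cvg_sumr (R : realType) (T I : Type) (F : set_system T) (FF : Filter F)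
    (r : seq I) (P : pred I) (f : I -> T -> R) (l : I -> R) :
  (forall i, P i -> f i x @[x --> F] --> l i) ->
  \sum_(i <- r | P i) f i x @[x --> F] --> \sum_(i <- r | P i) l i.
Proof. by move=> fl; apply: cvg_big => //; exact: add_continuous. Qed.

(** The common entries contribute equally, the rest of [r1] contributes 0 and the rest of [r2] is
    nonnegative. This bounds a sum over an arbitrary list by one over a list that carries the
    support of [f]. *)
Lemma ler_sum_uniq (R : realType) (T : eqType) (r1 r2 : seq T) (f : T -> R) :
  uniq r1 -> uniq r2 -> (forall y, 0 <= f y) ->
  (forall y, y \in r1 -> y \notin r2 -> f y = 0) ->
  \sum_(y <- r1) f y <= \sum_(y <- r2) f y.
Proof.
move=> u1 u2 f0 r12; rewrite [leLHS](bigID (mem r2))/= [leRHS](bigID (mem r1))/=.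
rewrite [X in _ + X <= _]big_seq_cond [X in _ + X <= _]big1; last first.
  by move=> y /andP[]; exact: r12.
rewrite addr0 -[in leLHS]big_filter -[X in _ <= X + _]big_filter.
suff -> : \sum_(y <- [seq y <- r1 | y \in r2]) f y =
          \sum_(y <- [seq y <- r2 | y \in r1]) f y by rewrite lerDl sumr_ge0.
apply/perm_big/uniq_perm; rewrite ?filter_uniq// => y.
by rewrite !mem_filter andbC.
Qed.

(** Duplicate-free lists stand for the finite sets in the supremum that defines [esum]; with this
    lemma and the next three, estimates on [esum] become estimates on big operators. *)
Lemma esum_ge_uniq (R : realType) (T : choiceType) (S : set T) (r : seq T)
    (f : T -> \bar R) :
  uniq r -> (forall y, y \in r -> S y) ->
  (\sum_(y <- r) f y <= \esum_(y in S) f y)%E.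
Proof.
move=> ur rS; apply: esum_ge; exists [set` r]; last by rewrite -fsbig_seq.
by split; [exact: finite_seq | exact: rS].
Qed.

Lemma esum_le_uniq (R : realType) (T : choiceType) (f : T -> \bar R) M :
  (forall r, uniq r -> (\sum_(y <- r) f y <= M)%E) ->
  (\esum_(y in [set: T]) f y <= M)%E.
Proof.
move=> rM; apply: ge_ereal_sup => _ [A [finA _] <-].
by rewrite fsbig_finite//; exact: rM.
Qed.

Lemma esum_gt_uniq (R : realType) (T : choiceType) (S : set T)
    (f : T -> \bar R) c :
  (c < \esum_(y in S) f y)%E -> exists r, [/\ uniq r,
    forall y, y \in r -> S y & (c < \sum_(y <- r) f y)%E].
Proof.
move=> /ereal_sup_gt[_ [A [finA AS] <-]]; rewrite fsbig_finite// => cA.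
exists (finmap.enum_fset (fset_set A)); split => // y; by rewrite in_fset_set// inE => /AS.
Qed.

Lemma esum_supp_uniq (R : realType) (T : choiceType) (r : seq T)
    (f : T -> \bar R) :
  uniq r -> (forall y, 0 <= f y)%E -> (forall y, y \notin r -> f y = 0%E) ->
  (\esum_(y in [set: T]) f y = \sum_(y <- r) f y)%E.
Proof.
move=> ur f0 fr; rewrite fsbig_seq// -esum_fset; [|exact: finite_seq|by []].
rewrite [RHS]esum_mkcond; apply: eq_esum => y _; case: ifPn => // yr.
by rewrite fr//; apply: contra yr => yr; rewrite inE.
Qed.

(* No mass escapes to infinity, since the limit has mass 1: Fatou's lemma bounds
   the mass of [S] from below, and applied to the complement, from above. *)
Lemma cvg_esum_mass (R : realType) (T : choiceType) (p : nat -> T -> R)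
    (w : T -> R) (S : set T) :
  (forall t y, 0 <= p t y) ->
  (forall t, \esum_(y in [set: T]) (p t y)%:E <= 1)%E ->
  (forall y, p t y @[t --> \oo] --> w y) ->
  (\esum_(y in [set: T]) (w y)%:E = 1)%E ->
  fine (\esum_(y in S) (p t y)%:E)%E @[t --> \oo] -->
    fine (\esum_(y in S) (w y)%:E)%E.
Proof.
move=> p0 p1 pw w1.
have w0 y : 0 <= w y.
  by rewrite -(cvg_lim _ (pw y))//; apply: limr_ge; [exact/cvgP/pw|exact: nearW].
have fatou (A : set T) c : (c < \esum_(y in A) (w y)%:E)%E ->
    \forall t \near \oo, (c < \esum_(y in A) (p t y)%:E)%E.
  (* A finite list already exceeds [c] under [w], and finite sums converge. *)
  move=> /esum_gt_uniq[r [ur rA]]; rewrite sumEFin.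
  case: c => [c||]; [|by []|by move=> _; near=> t; rewrite (lt_le_trans (ltNyr 0))//
    esum_ge0// => y _; rewrite lee_fin].
  rewrite lte_fin => cr.
  have : \sum_(y <- r) p t y @[t --> \oo] --> \sum_(y <- r) w y.
    exact: cvg_sumr.
  move=> /cvgr_gt -/(_ _ cr); apply: filterS => t ct.
  by apply: lt_le_trans (esum_ge_uniq _ ur rA); rewrite sumEFin lte_fin.
have split1 (f : T -> R) : (forall y, 0 <= f y) ->
    (\esum_(y in [set: T]) (f y)%:E =
     \esum_(y in S) (f y)%:E + \esum_(y in ~` S) (f y)%:E)%E.
  by move=> f0; rewrite (esumID S)// ?setTI// => y _; rewrite lee_fin.
have fin (f : T -> R) (A : set T) : (forall y, 0 <= f y) ->
    (\esum_(y in [set: T]) (f y)%:E <= 1)%E ->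
    (\esum_(y in A) (f y)%:E)%E \is a fin_num.
  move=> f0 f1; rewrite ge0_fin_numE; last first.
    by apply: esum_ge0 => y _; rewrite lee_fin.
  apply: (@le_lt_trans _ _ 1%E); last by rewrite ltry.
  apply: le_trans f1; rewrite esum_mkcond; apply: le_esum => y _.
  by case: ifP; rewrite lee_fin.
have wfin A : (\esum_(y in A) (w y)%:E)%E \is a fin_num by apply: fin; rewrite ?w1.
have pfin t A : (\esum_(y in A) (p t y)%:E)%E \is a fin_num by apply: fin.
apply/cvgrPdist_lt => e e0.
have H1 : ((fine (\esum_(y in S) (w y)%:E) - e)%:E < \esum_(y in S) (w y)%:E)%E.
  by rewrite -[ltRHS]fineK// lte_fin ltrBlDr ltrDl.
have H2 : ((fine (\esum_(y in ~` S) (w y)%:E) - e)%:E <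
    \esum_(y in ~` S) (w y)%:E)%E.
  by rewrite -[ltRHS]fineK// lte_fin ltrBlDr ltrDl.
move: (split1 _ w0) (fatou _ _ H1) (fatou _ _ H2); rewrite w1.
rewrite -[in X in (_ = X)%E](fineK (wfin S)) -[in X in (_ = X)%E](fineK (wfin (~` S))).
move=> /eqP; rewrite eqe => /eqP ws A B; near=> t.
have : ((fine (\esum_(y in S) (w y)%:E) - e)%:E < \esum_(y in S) (p t y)%:E)%E.
  by near: t.
have : ((fine (\esum_(y in ~` S) (w y)%:E) - e)%:E <
        \esum_(y in ~` S) (p t y)%:E)%E by near: t.
have := p1 t; rewrite (split1 _ (p0 t)).
rewrite -(fineK (pfin t S)) -(fineK (pfin t (~` S))) [fine (fine _)%:E]/=.
rewrite -EFinD lee_fin !lte_fin ltr_norml => a1 a2 a3.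
move: ws a1 a2 a3.
set x := fine _; set x' := fine _; set y := fine _; set y' := fine _ => ws a1 a2 a3.
by apply/andP; split; lra.
Unshelve. all: by end_near. Qed.

(** * Invertibility of [1 - C] *)

Lemma expmx_ge0 (R : realType) (m : nat) (P : 'M[R]_m) (k : nat) i j :
  (forall i j, 0 <= P i j) -> 0 <= (P ^+ k) i j.
Proof.
move=> P0; elim: k i j => [|k IH] i j; first by rewrite expr0 !mxE ler0n.
by rewrite exprS -[_ * _]/(_ *m _) mxE; apply: sumr_ge0 => l _; rewrite mulr_ge0.
Qed.

(* If [v C = v] with [v != 0], then [|v| <= |v| C] and, [C] being substochastic,
   [|v| C = |v|] and [|v| D = 0]; so [|v|] is invariant under the irreducible
   [C + D], hence positive, which forces [D = 0]. *)
Lemma unitmx_subC (R : realType) (m : nat) (C D : 'M[R]_m) :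
  DMAP C D -> (1%:M - C) \in unitmx.
Proof.
move=> [[C0 _] [D0 [i1 [j1 D1]]] [P0 P1] irr].
rewrite unitmxE unitfE; apply/negP => /det0P[v v0]; rewrite mulmxBr mulmx1.
move=> /eqP; rewrite subr_eq0 => /eqP vC.
pose a : 'rV[R]_m := \row_j `|v 0 j|.
have a0 j : 0 <= a 0 j by rewrite mxE.
have aC j : a 0 j <= (a *m C) 0 j.
  rewrite [a 0 j]mxE vC !mxE; apply: le_trans (ler_norm_sum _ _ _) _.
  by apply: ler_sum => i _; rewrite mxE normrM [`|C _ _|]ger0_norm.
have D0' j : 0 <= (a *m D) 0 j.
  by rewrite mxE; apply: sumr_ge0 => i _; rewrite mulr_ge0.
have aCD j : (a *m C) 0 j + (a *m D) 0 j = (a *m (C + D)) 0 j.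
  by rewrite mulmxDr [RHS]mxE.
(* The rows of [C + D] sum to 1, so the excess of [a *m (C + D)] over [a] has total 0; its entries
   are nonnegative, hence all zero. *)
have sumP : \sum_j ((a *m C) 0 j + (a *m D) 0 j - a 0 j) = 0.
  rewrite sumrB; apply/eqP; rewrite subr_eq0; apply/eqP.
  under eq_bigr do rewrite aCD mxE.
  rewrite exchange_big/=; apply: eq_bigr => i _.
  by rewrite -mulr_sumr P1 mulr1.
have allP j : (a *m C) 0 j + (a *m D) 0 j - a 0 j = 0.
  move/eqP: sumP; rewrite psumr_eq0; last first.
    by move=> k _; rewrite addrAC addr_ge0// subr_ge0.
  by move=> /allP/(_ j); rewrite mem_index_enum => /(_ isT)/eqP.
have aD j : (a *m D) 0 j = 0.
  apply/eqP; rewrite eq_le D0' andbT.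
  by move: (allP j) (aC j) => /eqP; rewrite subr_eq0 => /eqP <-; rewrite gerDl.
have aP : a *m (C + D) = a.
  by apply/rowP => j; rewrite -aCD; apply/eqP; rewrite -subr_eq0 allP.
have aPk k : a *m ((C + D) ^+ k) = a.
  elim: k => [|k IH]; first by rewrite expr0 mulmx1.
  by rewrite exprS -[_ * _]/(_ *m _) mulmxA aP.
have [i ai] : exists i, 0 < a 0 i.
  apply/existsP; apply: contraNT v0 => /existsPn aN.
  apply/eqP/rowP => i; rewrite mxE; apply/eqP; move: (aN i).
  by rewrite mxE normr_gt0 negbK.
(* Some power of [C + D] carries the positive entry at [i] to [i1]; as [D i1 j1 > 0], this
   contradicts [aD j1]. *)
have [k Pk] := irr i i1.
have ai1 : 0 < a 0 i1.
  rewrite -(aPk k) mxE (bigD1 i)//=; apply: ltr_wpDr; last exact: mulr_gt0.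
  by apply: sumr_ge0 => l _; rewrite mulr_ge0// expmx_ge0.
have := aD j1; rewrite mxE => /eqP; rewrite psumr_eq0; last first.
  by move=> l _; rewrite mulr_ge0.
move=> /seq.allP/(_ i1); rewrite mem_index_enum => /(_ isT)/eqP.
by apply/eqP; rewrite gt_eqF// mulr_gt0.
Qed.

(** * The law of the chain at finite times *)

Section Chain.
Variables (R : realType) (m a b : nat) (C D : 'M[R]_m) (s : nat -> nat -> R).
Hypotheses (hCD : DMAP C D) (hab : (a <= b)%N).
Hypothesis hs : forall r, (a <= r)%N -> (r <= b)%N -> service_law s r.

Lemma phase_step_ge0 x i j : 0 <= phase_step C D x i j.
Proof. by case: hCD => -[C0 _] [D0 _] _ _; case: x. Qed.

Lemma bulk_start_ge0 n c : 0 <= bulk_start a b s n c.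
Proof.
rewrite /bulk_start; case: ltnP => an; first exact: ler0n.
case: c => // -[[n' r] [|u]]; first by rewrite !andbF.
case: ifP => // /and3P[/eqP -> _ _].
by have [] := hs (r := minn n b); rewrite ?geq_minr// leq_min an hab.
Qed.

Lemma config_step_ge0 c x c' : 0 <= config_step a b s c x c'.
Proof.
case: c => [n|[[n r] u]] /=; first exact: bulk_start_ge0.
by case: ifP => _; [exact: bulk_start_ge0 | exact: ler0n].
Qed.

Lemma transition_ge0 (y z : state m) : 0 <= transition C D a b s y z.
Proof.
apply: sumr_ge0 => x _.
by rewrite mulr_ge0 ?phase_step_ge0 ?config_step_ge0.
Qed.

(** From [a] customers on, the batch size is forced to be [minn n b], so only the service time is
    random and the sum is at most a partial sum of the service law. *)
Lemma bulk_start_mass n (l : seq config) :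
  uniq l -> \sum_(c <- l) bulk_start a b s n c <= 1.
Proof.
move=> ul; have [na|an] := ltnP n a.
  apply: le_trans (ler_sum_uniq (r2 := [:: Idle n]) ul _ (bulk_start_ge0 n) _) _.
  - by [].
  - by move=> c _; rewrite inE /bulk_start na => /negPf ->.
  - by rewrite big_seq1 /bulk_start na eqxx.
pose r := minn n b.
have [s0 s1 _] : service_law s r by apply: hs; rewrite ?geq_minr// leq_min an hab.
(* [U] bounds the service times occurring in [l], so the first [U] values carry all the weight of
   [l]. *)
pose U := (\max_(c <- l) (if c is inr (_, _, u) then u else 0))%N.
pose h u := Busy (n - r) r u.+1.
have hinj : injective h by move=> u u' [].
apply: le_trans (ler_sum_uniq (r2 := [seq h u | u <- iota 0 U]) ul _
  (bulk_start_ge0 n) _) _.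
- by rewrite map_inj_uniq// iota_uniq.
- move=> c cl; rewrite /bulk_start ltnNge an /=.
  case: c cl => // -[[n' r'] u] cl; case: ifP => // /and3P[/eqP -> /eqP -> u0].
  case/negP; apply/mapP; exists u.-1; last by rewrite /h prednK.
  rewrite mem_iota/= add0n prednK// /U.
  by rewrite (@leq_bigmax_seq _ _ xpredT (fun c : config =>
    if c is inr (_, _, u) then u else 0%N) _ cl).
have sU : series (fun k => s r k.+1) U <= 1.
  rewrite -(cvg_lim _ s1)//; apply: nondecreasing_cvgn_le; last exact: cvgP s1.
  by apply/nondecreasing_series => k _ _; exact: s0.
rewrite big_map; apply: le_trans sU.
rewrite /series/= /index_iota subn0; apply: ler_sum => u _.
by rewrite /bulk_start ltnNge an /= !eqxx.
Qed.

Lemma config_step_mass c x (l : seq config) :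
  uniq l -> \sum_(c' <- l) config_step a b s c x c' <= 1.
Proof.
move=> ul; case: c => [n|[[n r] u]] /=; first exact: bulk_start_mass.
case: (u == 1%N); first exact: bulk_start_mass.
pose f c' : R := (c' == Busy (n + x) r u.-1)%:R.
apply: le_trans (_ : \sum_(c' <- [:: Busy (n + x) r u.-1]) f c' <= _).
  apply: (ler_sum_uniq ul) => // c' _.
  by rewrite inE /f => /negPf ->.
by rewrite big_seq1 /f eqxx.
Qed.

(** The list is enlarged to the product of its distinct configurations with all phases; summing out
    the configurations leaves the row sum of [C + D]. *)
Lemma transition_mass (y : state m) (l : seq (state m)) :
  uniq l -> \sum_(z <- l) transition C D a b s y z <= 1.
Proof.
move=> ul; pose cs := undup (map fst l).
have ucs : uniq cs by rewrite undup_uniq.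
apply: le_trans (ler_sum_uniq (r2 := [seq (c, j) | c <- cs, j <- enum 'I_m])
  ul _ (transition_ge0 y) _) _.
- by apply: allpairs_uniq; rewrite ?enum_uniq// => -[? ?] [? ?] _ _.
- move=> [c j] cl /allpairsP; case; exists (c, j); split => //=.
    by rewrite mem_undup; apply/mapP; exists (c, j).
  by rewrite mem_enum.
case: hCD => _ _ [_ /(_ y.2) <-] _.
rewrite big_allpairs/= exchange_big/= big_enum/=; apply: ler_sum => j _.
rewrite exchange_big/= mxE big_bool/= [leLHS]addrC.
by apply: lerD; rewrite -mulr_sumr ler_piMr ?config_step_mass//;
  [exact: (phase_step_ge0 false)|exact: (phase_step_ge0 true)].
Qed.

Variable q : state m -> R.
Hypothesis hq : initial_law a b q.

Notation law := (law C D a b s q).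
Notation prob := (prob C D a b s q).

Lemma law_ge0 t z : (0 <= law t z)%E.
Proof.
elim: t z => [|t IH] z /=; first by case: hq => q0 _ _; rewrite lee_fin.
by apply: esum_ge0 => y _; rewrite mule_ge0// lee_fin transition_ge0.
Qed.

(** The inequality is enough: it makes the law finite, as [lawE] needs, and it is the mass bound
    assumed in [cvg_esum_mass]. *)
Lemma law_mass t : (\esum_(z in [set: state m]) law t z <= 1)%E.
Proof.
elim: t => [|t IH]; first by case: hq => _ /= ->.
apply: esum_le_uniq => r ur /=; rewrite -esum_sum; last first.
  by move=> y z _ _; rewrite mule_ge0 ?law_ge0// lee_fin transition_ge0.
apply: le_trans IH; apply: le_esum => y _.
rewrite -ge0_sume_distrr; last by move=> z _; rewrite lee_fin transition_ge0.
by rewrite sumEFin -[leRHS]mule1 lee_wpmul2l ?law_ge0// lee_fin transition_mass.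
Qed.

Lemma law_le1 t z : (law t z <= 1)%E.
Proof.
apply: le_trans (law_mass t).
by have := @esum_ge_uniq R _ setT [:: z] (law t); rewrite big_seq1; exact.
Qed.

Lemma lawE t z : law t z = (prob t z)%:E.
Proof.
rewrite /prob fineK// ge0_fin_numE ?law_ge0//.
exact: le_lt_trans (law_le1 t z) (ltry 1).
Qed.

Lemma prob_ge0 t z : 0 <= prob t z.
Proof. by rewrite -lee_fin -lawE law_ge0. Qed.

(** Admissible states lead only to admissible ones. The law thus never charges the others, and
    [prob_step] may ignore them as predecessors. *)
Lemma transition_admissible (y z : state m) :
  admissible a b y.1 -> ~~ admissible a b z.1 -> transition C D a b s y z = 0.
Proof.
move=> ya zN; have bulk n : bulk_start a b s n z.1 = 0.
  rewrite /bulk_start; case: ltnP => an.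
    by case: eqP zN => // -> /=; rewrite an.
  case: z.1 zN => // -[[n' r] u] /= zN; case: ifP => // /and3P[/eqP er _ u0].
  by move: zN; rewrite u0 er geq_minr leq_min an hab.
apply: big1 => x _; rewrite (_ : config_step _ _ _ _ _ _ = 0) ?mulr0//.
case: y.1 ya => [n|[[n r] [|u]]] /= ya; rewrite ?andbF// in ya *.
case: ifP => [_|u1]; first exact: bulk.
case: eqP zN => // -> /=; rewrite andbT in ya; case/andP: ya => -> ->.
by rewrite lt0n; move: u1; case: u.
Qed.

Lemma prob_admissible t z : ~~ admissible a b z.1 -> prob t z = 0.
Proof.
rewrite /prob; elim: t z => [|t IH] z zN /=; first by case: hq => _ _ ->.
rewrite esum1// => y _; case: (boolP (admissible a b y.1)) => ya.
  by rewrite transition_admissible// mule0.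
by rewrite lawE [prob t y](IH _ ya) mul0e.
Qed.

(** [pre x] must contain the admissible predecessors of [c'] under [x], but may be larger; being
    finite, it turns the infinite sum over states into one that passes to the limit. *)
Lemma prob_step t c' j (pre : bool -> seq config) :
  (forall x, uniq (pre x)) ->
  (forall x c, admissible a b c -> c \notin pre x ->
     config_step a b s c x c' = 0) ->
  prob t.+1 (c', j) = \sum_x \sum_(c <- pre x) config_step a b s c x c' *
    \sum_i prob t (c, i) * phase_step C D x i j.
Proof.
move=> upre pre0; apply: EFin_inj; rewrite -lawE/=.
under eq_esum => y _ do rewrite lawE -EFinM /transition mulr_sumr -sumEFin.
rewrite esum_sum; last first.
  move=> y x _ _; rewrite lee_fin mulr_ge0 ?prob_ge0//.
  by rewrite mulr_ge0 ?phase_step_ge0 ?config_step_ge0.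
rewrite -sumEFin; apply: eq_bigr => x _.
rewrite (@esum_supp_uniq _ _ [seq (c, i) | c <- pre x, i <- enum 'I_m]).
- rewrite big_allpairs -sumEFin; apply: eq_bigr => c _.
  rewrite sumEFin big_enum/= mulr_sumr; congr (_%:E); apply: eq_bigr => i _.
  by rewrite [LHS]mulrA mulrC.
- by apply: allpairs_uniq; rewrite ?enum_uniq// => -[? ?] [? ?] _ _.
- move=> y; rewrite lee_fin mulr_ge0 ?prob_ge0//.
  by rewrite mulr_ge0 ?phase_step_ge0 ?config_step_ge0.
- move=> [c i] /= cN; case: (boolP (admissible a b c)) => ca; last first.
    by rewrite prob_admissible// mul0r.
  rewrite pre0 ?mulr0//; apply: contra cN => cpre.
  by apply/allpairsP; exists (c, i); rewrite mem_enum.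
Qed.

End Chain.

(* [slot X n] is the vector of finding [n] customers after the potential arrival
   of a slot, when [X k] is the vector of finding [k] customers before it. *)
Definition slot (R : realType) (m : nat) (C D : 'M[R]_m)
    (X : nat -> 'rV[R]_m) (n : nat) : 'rV[R]_m :=
  \sum_(x : bool | (x <= n)%N) X (n - x)%N *m phase_step C D x.

(** * Linearity and continuity of [slot] *)

Section SlotTheory.
Variables (R : realType) (m : nat) (C D : 'M[R]_m).
Implicit Types X Y : nat -> 'rV[R]_m.

Lemma slot0 X : slot C D X 0 = X 0%N *m C.
Proof. by rewrite /slot big_mkcond big_bool/= add0r. Qed.

Lemma slotS X n : slot C D X n.+1 = X n.+1 *m C + X n *m D.
Proof. by rewrite /slot big_mkcond big_bool/= subn0 subn1 addrC. Qed.

Lemma slotD X Y n : slot C D (fun k => X k + Y k) n = slot C D X n + slot C D Y n.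
Proof. by rewrite /slot -big_split; apply: eq_bigr => x _; rewrite mulmxDl. Qed.

Lemma slotB X Y n : slot C D (fun k => X k - Y k) n = slot C D X n - slot C D Y n.
Proof. by rewrite /slot -sumrB; apply: eq_bigr => x _; rewrite mulmxBl. Qed.

Lemma slot_sum (I : Type) (r : seq I) (P : pred I) (X : I -> nat -> 'rV[R]_m) n :
  slot C D (fun k => \sum_(i <- r | P i) X i k) n =
  \sum_(i <- r | P i) slot C D (X i) n.
Proof.
by rewrite /slot exchange_big/=; apply: eq_bigr => x _; rewrite mulmx_suml.
Qed.

Lemma cvg_slot (X : nat -> nat -> 'rV[R]_m) Y n j :
  (forall k i, X t k 0 i @[t --> \oo] --> Y k 0 i) ->
  slot C D (X t) n 0 j @[t --> \oo] --> slot C D Y n 0 j.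
Proof.
move=> XY; rewrite /slot summxE.
under eq_fun do rewrite summxE.
apply: cvg_sumr => x _; rewrite mxE; under eq_fun do rewrite mxE.
by apply: cvg_sumr => i _; exact: cvgMl.
Qed.

End SlotTheory.

(** * Explicit weights of the bulk service rule *)

Lemma bulk_start_idle (R : realType) (a b : nat) (s : nat -> nat -> R) k n :
  (n < a)%N -> bulk_start a b s k (Idle n) = (k == n)%:R.
Proof.
move=> na; rewrite /bulk_start /Idle; case: ltnP => ak; last by case: eqP => //; lia.
by congr (_%:R); apply: f_equal; apply/eqP/eqP => [[]|->].
Qed.

(** As [minn k b] never exceeds [k], the truncated equation [n = k - r] becomes [k = n + r]. The
    remaining test involves only the target, not the predecessor. *)
Lemma bulk_start_busy (R : realType) (a b : nat) (s : nat -> nat -> R) k n r u :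
  (a <= r)%N -> (0 < u)%N ->
  bulk_start a b s k (Busy n r u) =
  ((r == minn (n + r) b) && (k == n + r)%N)%:R * s r u.
Proof.
move=> ar u0; rewrite /bulk_start /Busy u0 andbT; case: ltnP => ak.
  by rewrite (_ : k == _ = false) ?andbF ?mul0r//; apply/eqP; lia.
case: ifP => [/andP[/eqP e1 /eqP e2]|H].
  by rewrite (_ : _ && _ = true) ?mul1r//; apply/andP; split; apply/eqP; lia.
rewrite (_ : _ && _ = false) ?mul0r//; apply: contraFF H => /andP[/eqP e1 /eqP e2].
by apply/andP; split; apply/eqP; lia.
Qed.

(** * Balance equations of the limiting probabilities *)

Section SteadyState.
Variables (R : realType) (m a b : nat) (C D : 'M[R]_m) (s : nat -> nat -> R).
Hypotheses (hCD : DMAP C D) (ha : (1 <= a)%N) (hab : (a <= b)%N).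
Hypothesis hs : forall r, (a <= r)%N -> (r <= b)%N -> service_law s r.
Variable q : state m -> R.
Hypotheses (hq : initial_law a b q) (hlim : has_steady_state C D a b s q).

Notation prob := (prob C D a b s q).
Notation w := (limit_prob C D a b s q).
Notation slot := (slot C D).

Lemma cvg_prob z : prob t z @[t --> \oo] --> w z.
Proof. exact: hlim.1. Qed.

Lemma limit_prob_ge0 z : 0 <= w z.
Proof.
by apply: limr_ge; [exact: hlim.1|apply: nearW => t; exact: (prob_ge0 hCD hab hs hq)].
Qed.

Lemma limit_prob_admissible z : ~~ admissible a b z.1 -> w z = 0.
Proof.
move=> zN; apply/cvg_lim => //.
under eq_fun do rewrite (prob_admissible hCD hab hs hq)//.
exact: cvg_cst.
Qed.

Definition limit_row (c : config) : 'rV[R]_m := \row_i w (c, i).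
Notation W := limit_row.

Lemma limit_row_step c' (pre : bool -> seq config) :
  (forall x, uniq (pre x)) ->
  (forall x c, admissible a b c -> c \notin pre x ->
     config_step a b s c x c' = 0) ->
  W c' = \sum_x \sum_(c <- pre x)
    config_step a b s c x c' *: (W c *m phase_step C D x).
Proof.
move=> upre pre0; apply/rowP => j; rewrite mxE summxE.
have: prob t.+1 (c', j) @[t --> \oo] --> w (c', j).
  by rewrite (cvg_shiftS (fun t => prob t (c', j))); exact: cvg_prob.
move/cvg_lim => <- //; apply/cvg_lim => //.
under eq_fun do rewrite (prob_step hCD hab hs hq _ j upre pre0).
apply: cvg_sumr => x _; rewrite summxE; apply: cvg_sumr => c _.
rewrite !mxE; apply: cvgMr; apply: cvg_sumr => i _; rewrite mxE.
by apply: cvgMl; exact: cvg_prob.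
Qed.

(** A batch with remaining time 1 departs in the current slot, so for the next start it acts as an
    idle server: both move by [bulk_start] at [n + x]. *)
Definition free_row (n : nat) : 'rV[R]_m :=
  W (Idle n) + \sum_(a <= r < b.+1) W (Busy n r 1).

Let free (n : nat) : seq config :=
  Idle n :: [seq Busy n r 1 | r <- index_iota a b.+1].

Let free_uniq n : uniq (free n).
Proof.
rewrite /free /= map_inj_uniq ?iota_uniq ?andbT; last by move=> r r' [].
by apply/mapP => -[r].
Qed.

(** By the remaining service time: 0 is inadmissible, 1 frees the server, and a larger value only
    counts down. *)
Let config_step_free c x c' : admissible a b c ->
  (exists2 k, c \in free k & config_step a b s c x c' = bulk_start a b s (k + x) c')
  \/ exists n r u, [/\ (0 < u)%N, c = Busy n r u.+1 &
       config_step a b s c x c' = (c' == Busy (n + x) r u)%:R].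
Proof.
case: c => [n _|[[n r] [|[|u]]]] /=.
- by left; exists n; rewrite // mem_head.
- by rewrite !andbF.
- rewrite andbT => rab; left; exists n => //; rewrite inE; apply/orP; right.
  by apply/mapP; exists r => //; rewrite mem_index_iota.
- by move=> _; right; exists n, r, u.+1.
Qed.

Let sum_free (f : config -> bool -> R) n x (v : R) :
  (forall c, c \in free n -> f c x = v) ->
  \sum_(c <- free n) f c x *: (W c *m phase_step C D x) =
  v *: (free_row n *m phase_step C D x).
Proof.
move=> fv; rewrite big_seq (eq_bigr (fun c => v *: (W c *m phase_step C D x))).
  rewrite -big_seq -scaler_sumr -mulmx_suml; congr (_ *: (_ *m _)).
  by rewrite /free big_cons big_map.
by move=> c /fv ->.
Qed.

Let config_step_in_free c n x c' : c \in free n ->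
  config_step a b s c x c' = bulk_start a b s (n + x) c'.
Proof. by rewrite inE => /orP[/eqP ->//|/mapP[r _ ->]]. Qed.

Lemma limit_row_idle n : (n < a)%N -> W (Idle n) = slot free_row n.
Proof.
(* For [n = 0] with an arrival, [n - x] truncates to 0; the weight of these listed predecessors is
   then 0, matching the guard [x <= n] of [slot]. *)
move=> na; rewrite (limit_row_step (pre := fun x => free (n - x))) => [|//|].
  rewrite /slot [RHS]big_mkcond; apply: eq_bigr => x _.
  rewrite (@sum_free (fun c x => config_step a b s c x (Idle n)) _ _ (x <= n)%:R).
    by case: ifP; rewrite (scale1r, scale0r).
  move=> c /config_step_in_free ->; rewrite bulk_start_idle//.
  by congr (_%:R); apply: f_equal; apply/eqP/idP; lia.
move=> x c cadm cN.
have [[k ck ->]|[k [r [u [u0 _ ->]]]]] := config_step_free x (Idle n) cadm.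
  rewrite bulk_start_idle//; case: eqP => // e.
  by move: cN; rewrite -e addnK ck.
by [].
Qed.

(** The two terms are the countdown of a running service and the start of a new one. For [r <= b]
    the indicator is 1 exactly when [n = 0] or [r = b], so one equation covers every busy case of
    the model. *)
Lemma limit_row_busy n r u : (a <= r)%N -> (r <= b)%N -> (0 < u)%N ->
  W (Busy n r u) = slot (fun k => W (Busy k r u.+1)) n +
    ((r == minn (n + r) b)%:R * s r u) *: slot free_row (n + r).
Proof.
move=> ar rb u0.
rewrite (limit_row_step
  (pre := fun x => Busy (n - x) r u.+1 :: free (n + r - x))) => [|x|].
- rewrite /slot [X in X + _]big_mkcond [X in _ *: X]big_mkcond.
  rewrite scaler_sumr -big_split/=; apply: eq_bigr => x _.
  (* Since [r >= a >= 1], the guard in the second [slot] always holds. *)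
  have -> : (x <= n + r)%N by case: x; lia.
  rewrite big_cons (@sum_free (fun c x => config_step a b s c x (Busy n r u)) _ _
    ((r == minn (n + r) b)%:R * s r u)).
    congr (_ + _); rewrite /= (_ : (_ == 1)%N = false); last by lia.
    have -> : (Busy n r u == Busy (n - x + x) r u) = (x <= n)%N.
      by apply/eqP/idP => [[]|xn]; [lia|congr Busy; lia].
    by case: ifP; rewrite (scale1r, scale0r).
  move=> c /config_step_in_free ->; rewrite bulk_start_busy// subnK.
    by rewrite eqxx andbT.
  by case: x; lia.
- rewrite cons_uniq free_uniq andbT inE; apply/negP => /orP[//|/mapP[i _ []]]; lia.
- move=> x c cadm; rewrite inE negb_or => /andP[cN1 cN2].
  have [[k ck ->]|[k [i [v [v0 ec ->]]]]] := config_step_free x (Busy n r u) cadm.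
    rewrite bulk_start_busy//; case: eqP => [e|]; rewrite ?andbF ?mul0r//.
    case: eqP => [e'|]; rewrite ?andbF ?mul0r//.
    by move: cN2; rewrite -e' addnK ck.
  case: eqP => // -[en er eu].
  by move: cN1; rewrite ec en er eu addnK eqxx.
Qed.

(** * Summation over the remaining service time *)

(** The partial sums increase and, running over distinct states, stay below the total mass 1. *)
Lemma cvgn_series_limit_prob (h : nat -> state m) :
  injective h -> cvgn (series (fun u => w (h u))).
Proof.
move=> hinj; apply: nondecreasing_is_cvgn.
  by apply/nondecreasing_series => k _ _; exact: limit_prob_ge0.
exists 1 => _ [N _ <-]; rewrite -lee_fin -hlim.2 /series/= -sumEFin.
rewrite -(big_map h xpredT (fun y => (w y)%:E)); apply: esum_ge_uniq => //.
by rewrite map_inj_uniq// iota_uniq.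
Qed.

Lemma cvg_pi_arb n r i :
  series (fun u => W (Busy n r u.+1) 0 i) @ \oo --> pi_arb C D a b s q n r 0 i.
Proof.
rewrite [X in _ --> X]mxE.
(* [cvgn] unfolds to convergence to [limn], which is how the entry of [pi_arb] is defined. *)
apply: (_ : cvgn (series (fun u => W (Busy n r u.+1) 0 i))).
rewrite (_ : (fun u => W _ 0 i) = (fun u => w (Busy n r u.+1, i))).
  by apply: (@cvgn_series_limit_prob (fun u => (Busy n r u.+1, i))) => u u' [].
by apply/funext => u; rewrite mxE.
Qed.

Lemma cvg_pi_arb_shift n r i :
  series (fun u => W (Busy n r u.+2) 0 i) @ \oo -->
  (pi_arb C D a b s q n r - W (Busy n r 1)) 0 i.
Proof.
have -> : (pi_arb C D a b s q n r - W (Busy n r 1)) 0 i =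
    pi_arb C D a b s q n r 0 i - W (Busy n r 1) 0 i.
  by rewrite [LHS]mxE [X in _ + X]mxE.
rewrite (_ : series _ = fun N => series (fun u => W (Busy n r u.+1) 0 i) N.+1 -
                                W (Busy n r 1) 0 i).
  apply: cvgB; last exact: cvg_cst.
  by rewrite (cvg_shiftS (series _)); exact: cvg_pi_arb.
by apply/funext => N; rewrite /series/= big_nat_recl// addrC addKr.
Qed.

(** Summing [limit_row_busy] over [u >= 1], the countdown term misses only remaining time 1, hence
    the subtracted [slot], and the service law sums to 1. *)
Lemma pi_arb_balance n r : (a <= r)%N -> (r <= b)%N ->
  pi_arb C D a b s q n r =
    slot (fun k => pi_arb C D a b s q k r) n - slot (fun k => W (Busy k r 1)) n +
    (r == minn (n + r) b)%:R *: slot free_row (n + r).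
Proof.
move=> ar rb; rewrite -slotB; apply/rowP => j.
rewrite -(cvg_lim _ (@cvg_pi_arb n r j))//; apply/cvg_lim => //.
have -> : series (fun u => W (Busy n r u.+1) 0 j) = fun N =>
    slot (fun k => \sum_(0 <= u < N) W (Busy k r u.+2)) n 0 j +
    (r == minn (n + r) b)%:R * series (fun u => s r u.+1) N *
      slot free_row (n + r) 0 j.
  apply/funext => N; rewrite slot_sum summxE /series/=.
  rewrite -mulrA mulr_suml mulr_sumr -big_split/=; apply: eq_bigr => u _.
  by rewrite limit_row_busy// !mxE mulrA.
rewrite [X in _ --> X]mxE [X in _ --> _ + X]mxE; apply: cvgD.
  apply: cvg_slot => k i; under eq_fun do rewrite summxE.
  exact: cvg_pi_arb_shift.
have [_ s1 _] := hs ar rb.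
by apply: cvgMl; rewrite -[X in _ --> X]mulr1; apply: cvgMr.
Qed.

(** * Departure epochs and the constant [Omega] *)

Let departures : set (state m) := [set y | departing y.1].

Let dep_mass : R := fine (\esum_(y in departures) (w y)%:E)%E.

Let dep_massE : (\esum_(y in departures) (w y)%:E = dep_mass%:E)%E.
Proof.
rewrite fineK// ge0_fin_numE; last first.
  by apply: esum_ge0 => y _; rewrite lee_fin limit_prob_ge0.
apply: le_lt_trans (ltry 1); rewrite -hlim.2 esum_mkcond; apply: le_esum => y _.
by case: ifP => _; rewrite lee_fin// limit_prob_ge0.
Qed.

(** Infinitely many states are departing, so pointwise convergence alone would not do;
    [cvg_esum_mass] supplies the exchange. *)
Lemma cvg_departure_prob :
  departure_prob C D a b s q t @[t --> \oo] --> dep_mass.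
Proof.
rewrite /departure_prob.
under eq_fun do under eq_esum do rewrite (lawE hCD hab hs hq).
apply: cvg_esum_mass => [t y|t|y|]; last exact: hlim.2.
- exact: (prob_ge0 hCD hab hs hq).
- by under eq_esum do rewrite -(lawE hCD hab hs hq); exact: (law_mass hCD hab hs hq).
- exact: cvg_prob.
Qed.

(** The iterated sum defining [Omega] is regrouped as one unordered sum over departing states. *)
Lemma Omega_inv : (Omega C D a b s q)^-1 = dep_mass.
Proof.
rewrite /Omega invrK; set f := (X in series X).
have fE n : f n = \sum_(a <= r < b.+1) \sum_i w (Busy n r 1, i).
  apply: eq_bigr => r _; rewrite mxE; apply: eq_bigr => i _.
  by rewrite !mxE mulr1.
have f0 n : 0 <= f n.
  by rewrite fE; do 2!apply: sumr_ge0 => ? _; exact: limit_prob_ge0.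
suff fmass : (\sum_(n <oo) (f n)%:E = dep_mass%:E)%E.
  apply/cvg_lim => //.
  have : (\sum_(0 <= n < N) (f n)%:E)%E @[N --> \oo] --> dep_mass%:E.
    by rewrite -fmass; apply: is_cvg_nneseries => n _ _; rewrite lee_fin.
  move/fine_cvgP => [_]; apply: cvg_trans; apply: near_eq_cvg.
  by apply: nearW => N /=; rewrite sumEFin.
rewrite nneseries_esumT => [|n]; last by rewrite lee_fin.
rewrite -dep_massE.
(* The batch size here ranges over all naturals; sizes outside [[a, b]] are inadmissible and drop
   out below. *)
rewrite (@reindex_esum _ _ _ [set: nat * (nat * 'I_m)] departures
  (fun k => (Busy k.1 k.2.1 1, k.2.2))); last first.
  split=> [k _//|k k' _ _ [e1 e2 e3]|[[n|[[n r] u]] i] //= /eqP ->].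
    by case: k k' e1 e2 e3 => [n [r i]] [n' [r' i']] /= -> -> ->.
  by exists (n, (r, i)).
rewrite (_ : [set: _] = [set: nat] `*`` (fun=> [set: nat * 'I_m])); last first.
  by apply/seteqP; split.
rewrite -(@esum_esum _ _ _ setT (fun=> setT)
  (fun n k => (w (Busy n k.1 1, k.2))%:E)); last first.
  by move=> *; rewrite lee_fin limit_prob_ge0.
apply: eq_esum => n _; rewrite (@esum_supp_uniq _ _
  [seq (r, i) | r <- index_iota a b.+1, i <- enum 'I_m]).
- rewrite big_allpairs fE -sumEFin; apply: eq_bigr => r _.
  by rewrite -sumEFin big_enum.
- by apply: allpairs_uniq; rewrite ?iota_uniq ?enum_uniq// => -[? ?] [? ?] _ _.
- by move=> k; rewrite lee_fin limit_prob_ge0.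
- move=> [r i] rN; rewrite limit_prob_admissible//=; apply: contra rN => rab.
  apply/allpairsP; exists (r, i); rewrite mem_enum mem_index_iota; split => //.
  by rewrite ltnS; case/and3P: rab => -> ->.
Qed.

(* If departures have zero probability then [Omega] is 0, and both sides vanish
   whatever the value of [pi_dep]. *)
Lemma pi_dep_scaled n r :
  (Omega C D a b s q)^-1 *: pi_dep C D a b s q n r =
  slot (fun k => W (Busy k r 1)) n.
Proof.
rewrite Omega_inv; have [d0|dN] := eqVneq dep_mass 0.
  rewrite d0 scale0r; apply/esym/big1 => x _.
  rewrite (_ : W _ = 0) ?mul0mx//; apply/rowP => i; rewrite !mxE.
  (* A single departing state weighs at most [dep_mass], here 0. *)
  apply/eqP; rewrite eq_le limit_prob_ge0 andbT -lee_fin -d0 -dep_massE.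
  have := @esum_ge_uniq R _ departures [:: (Busy (n - x) r 1, i)]
    (fun y => (w y)%:E) isT.
  by rewrite big_seq1; apply=> y; rewrite inE => /eqP ->.
apply/rowP => j; rewrite !mxE mulrC -[RHS](divfK dN); congr (_ * _).
apply/cvg_lim => //; apply: cvgM; last exact: cvgV cvg_departure_prob.
rewrite (_ : (fun t => departure_state_prob _ _ _ _ _ _ t n r j) =
  fun t => slot (fun k => \row_i prob t (Busy k r 1, i)) n 0 j).
  apply: cvg_slot => k i; under eq_fun do rewrite mxE.
  by rewrite mxE; exact: cvg_prob.
apply/funext => t; rewrite summxE; apply: eq_bigr => x _; rewrite mxE.
by apply: eq_bigr => i _; rewrite mxE.
Qed.

Lemma slot_free_row n :
  slot free_row n = slot (p_idle C D a b s q) n +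
    (Omega C D a b s q)^-1 *: phi_dep C D a b s q n.
Proof.
rewrite /free_row slotD slot_sum scaler_sumr; congr (_ + _).
by apply: eq_bigr => r _; rewrite pi_dep_scaled.
Qed.

(** This extends [p_idle] by 0, so that [slot] of it makes sense at every index: at [a] only the
    arrival term from [a.-1] survives, and beyond [a] nothing does. *)
Lemma p_idle0 n : (a <= n)%N -> p_idle C D a b s q n = 0.
Proof.
by move=> an; apply/rowP => i; rewrite !mxE limit_prob_admissible//= -leqNgt.
Qed.

End SteadyState.

(** * Solving the linear relations *)

Theorem theorem1 (R : realType) (m a b : nat)
    (C D : 'M[R]_m) (s : nat -> nat -> R) (pibar : 'rV[R]_m)
    (q : state m -> R)
    (hm : (1 <= m)%N) (ha : (1 <= a)%N) (hab : (a <= b)%N)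
    (hCD : DMAP C D)
    (hs : forall r : nat, (a <= r)%N -> (r <= b)%N -> service_law s r)
    (hpibar : stationary_vector (C + D) pibar)
    (hrho : arrival_rate D pibar / (b%:R * service_rate s b) < 1)
    (hq : initial_law a b q)
    (hlim : has_steady_state C D a b s q) :
  let p := p_idle C D a b s q in
  let pi := pi_arb C D a b s q in
  let pi_plus := pi_dep C D a b s q in
  let phi_plus := phi_dep C D a b s q in
  let Om := Omega C D a b s q in
  let V := invmx (1%:M - C) in
  (forall n : nat, (n <= a.-1)%N ->
     p n = Om^-1 *: ((\sum_(0 <= j < n.+1)
                       phi_plus j *m (Dbar C D) ^+ (n - j)%N) *m V)) /\
  (pi 0%N a = (p a.-1 *m D + Om^-1 *: (phi_plus a - pi_plus 0%N a)) *m V) /\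
  (forall r : nat, (a.+1 <= r)%N -> (r <= b)%N ->
     pi 0%N r = (Om^-1 *: (phi_plus r - pi_plus 0%N r)) *m V) /\
  (forall n r : nat, (1 <= n)%N -> (a <= r)%N -> (r <= b.-1)%N ->
     pi n r = (pi n.-1 r *m D - Om^-1 *: pi_plus n r) *m V) /\
  (forall n : nat, (1 <= n)%N ->
     pi n b = (pi n.-1 b *m D + Om^-1 *: (phi_plus (n + b)%N - pi_plus n b)) *m V).
Proof.
move=> p pi pi_plus phi_plus Om V.
have unitC := unitmx_subC hCD.
(* All five identities are reduced to this form, the term [x *m C] being the slot without
   arrival. *)
have solve (x y : 'rV[R]_m) : x = x *m C + y -> x = y *m V.
  move=> xE; rewrite -[LHS](mulmxK unitC); congr (_ *m _).
  by rewrite mulmxBr mulmx1 {1}xE addrAC subrr add0r.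
have pE n : (n < a)%N -> p n = slot C D p n + Om^-1 *: phi_plus n.
  by move=> na; rewrite -slot_free_row// -limit_row_idle.
have p0 n : (a <= n)%N -> p n = 0 by exact: p_idle0.
have piE n r : (a <= r)%N -> (r <= b)%N ->
    pi n r = slot C D (pi ^~ r) n - Om^-1 *: pi_plus n r +
      (r == minn (n + r) b)%:R *:
        (slot C D p (n + r) + Om^-1 *: phi_plus (n + r)%N).
  by move=> ar rb; rewrite -slot_free_row// pi_dep_scaled//; exact: pi_arb_balance.
split; [|split; [|split; [|split]]].
- elim=> [|n IH] na.
    rewrite big_nat1 expr0 mulmx1 scalemxAl; apply: solve.
    by rewrite [LHS]pE ?slot0//; lia.
  rewrite big_nat_recr//= subnn expr0 mulmx1.
  rewrite scalemxAl; apply: solve.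
  rewrite [LHS]pE ?slotS; last by lia.
  rewrite -addrA; congr (_ + _); rewrite scalerDr; congr (_ + _).
  (* Multiplied by [D], each term of the sum for [n] gains one factor [V *m D], that is,
     [Dbar C D]. *)
  rewrite IH; last by lia.
  rewrite -scalemxAl; congr (_ *: _); rewrite -!mulmxA -/(Dbar C D) mulmx_suml.
  apply: eq_big_nat => j /andP[_ jn].
  by rewrite subSn// exprSr -[_ * _]/(_ *m _) mulmxA.
- apply: solve; rewrite [LHS]piE// slot0 add0n.
  rewrite (minn_idPl hab) eqxx scale1r scalerBr.
  have -> : slot C D p a = p a.-1 *m D.
    by rewrite -{1}(prednK ha) slotS prednK// p0// mul0mx add0r.
  by rewrite -!addrA; congr (_ + _); rewrite addrC addrA.
- move=> r ar rb; apply: solve; rewrite [LHS]piE//; last by lia.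
  rewrite slot0 add0n (_ : slot C D p r = 0).
    rewrite add0r (minn_idPl _)// eqxx scale1r scalerBr.
    by rewrite -!addrA; congr (_ + _); rewrite addrC.
  by case: r ar {rb} => // r ar; rewrite slotS !p0 ?mul0mx ?addr0//; lia.
- move=> [//|n] r _ ar rb; apply: solve; rewrite [LHS]piE//; last by lia.
  (* A batch smaller than [b] leaves nobody waiting when it starts, so no service start contributes
     for [n >= 1]. *)
  rewrite slotS (_ : (r == _) = false) ?scale0r ?addr0 ?addrA//.
  by apply/eqP; lia.
- move=> [//|n] _; apply: solve; rewrite [LHS]piE//.
  (* A full batch can start with any number left waiting; the idle terms vanish, since
     [n + b >= a]. *)
  rewrite (_ : (b == _) = true) ?scale1r; last by apply/eqP; lia.
  rewrite (_ : slot C D p (n.+1 + b) = 0).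
    rewrite add0r slotS scalerBr -!addrA; congr (_ + (_ + _)); exact: addrC.
  by rewrite addSn slotS !p0 ?mul0mx ?addr0//; lia.
Qed.
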